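(* Let $\mathcal{S}=\langle a_1,\ldots,a_n\rangle\subset\mathbb{Z}^m$ be a pointed semigroup with Hilbert series $\mathcal{H}_{\mathcal{S}}(\mathbf{t})$ and Möbius series $\mathcal{G}_{\mathcal{S}}(\mathbf{t})$. Then $$\mathcal{H}_{\mathcal{S}}(\mathbf{t})\cdot\mathcal{G}_{\mathcal{S}}(\mathbf{t})=1.$$
   Context: $\mathbb{N}=\{0,1,2,\ldots\}$. For nonzero vectors $a_1,\ldots,a_n\in\mathbb{Z}^m$, $\mathcal{S}=\langle a_1,\ldots,a_n\rangle=\{x_1a_1+\cdots+x_na_n \mid x_1,\ldots,x_n\in\mathbb{N}\}$ is the semigroup they generate. It is pointed if $\mathcal{S}\cap(-\mathcal{S})=\{0\}$. In that case $x\leq_{\mathcal{S}}y \iff y-x\in\mathcal{S}$ defines a locally finite partial order on $\mathbb{Z}^m$. For $l\geq 0$ let $c_l(x,y)$ be the number of chains $x=z_0<_{\mathcal{S}}z_1<_{\mathcal{S}}\cdots<_{\mathcal{S}}z_l=y$ of length $l$ in $\mathbb{Z}^m$; the Möbius function of $\mathcal{S}$ is $\mu_{\mathcal{S}}(x):=\sum_{l\ge 0}(-1)^l c_l(0,x)$ for $x\in\mathbb{Z}^m$ (a finite sum). For $b=(b_1,\ldots,b_m)\in\mathbb{Z}^m$, $\mathbf{t}^b:=t_1^{b_1}\cdots t_m^{b_m}$. $\mathbb{Z}[[t_1,\ldots,t_m,t_1^{-1},\ldots,t_m^{-1}]]$ denotes the set of all formal sums $\sum_{b\in\mathbb{Z}^m}f_b\mathbf{t}^b$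 with $f_b\in\mathbb{Z}$. The Hilbert series $\mathcal{H}_{\mathcal{S}}(\mathbf{t})$ of $\mathcal{S}$ is the multigraded Hilbert series of $k[x_1,\ldots,x_n]/I_{\mathcal{S}}$, where $k$ is a field, $\deg(x_i)=a_i$, and $I_{\mathcal{S}}$ is the kernel of the $k$-algebra map $k[x_1,\ldots,x_n]\to k[t_1^{\pm1},\ldots,t_m^{\pm1}]$, $x_i\mapsto\mathbf{t}^{a_i}$; equivalently, $\mathcal{H}_{\mathcal{S}}(\mathbf{t})=\sum_{b\in\mathcal{S}}\mathbf{t}^b$. The Möbius series is $\mathcal{G}_{\mathcal{S}}(\mathbf{t}):=\sum_{b\in\mathbb{Z}^m}\mu_{\mathcal{S}}(b)\,\mathbf{t}^b$. The product of the two series is the Cauchy product, whose coefficient at $\mathbf{t}^b$ is $\sum_{c\in\mathcal{S}}\mu_{\mathcal{S}}(b-c)$, a sum with only finitely many nonzero terms because $\mathcal{S}$ is pointed. *)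

(* Defs.v *)
From HB Require Import structures.
From mathcomp Require Import all_boot all_order all_algebra.
From mathcomp Require Import finmap mpoly.
From mathcomp Require Import boolp classical_sets cardinality fsbigop.

Set Implicit Arguments.
Unset Strict Implicit.
Unset Printing Implicit Defensive.

Import GRing.Theory.

Local Open Scope classical_set_scope.
Local Open Scope quotient_scope.
Local Open Scope ring_scope.

Section Semigroup.
Variables (m n : nat) (a : 'I_n -> 'rV[int]_m).

(* Both the element x_1 a_1 + ... + x_n a_n of the semigroup and the degree
   of the monomial with exponents x when the i-th variable has degree a_i. *)
Definition multidegree (x : 'I_n -> nat) : 'rV[int]_m := \sum_i a i *+ x i.

Definition semigroup : set 'rV[int]_m := range multidegree.

Definition pointed : Prop :=
  semigroup `&` [set - b | b in semigroup] = [set 0].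

Definition le_semigroup (x y : 'rV[int]_m) : Prop := semigroup (y - x).

Definition lt_semigroup (x y : 'rV[int]_m) : Prop :=
  le_semigroup x y /\ x <> y.

Definition chains (l : nat) (x y : 'rV[int]_m) :
    set {ffun 'I_l.+1 -> 'rV[int]_m} :=
  [set z | [/\ z ord0 = x, z ord_max = y &
    forall i : nat, (i < l)%N -> lt_semigroup (z (inord i)) (z (inord i.+1))]].
Arguments chains : clear implicits.

(* [fset_set] is the empty set on infinite sets; when the generators are
   nonzero and the semigroup is pointed, [chains l x y] is finite. *)
Definition nchains (l : nat) (x y : 'rV[int]_m) : nat :=
  #|` fset_set (chains l x y) |.

(* The sum over all naturals l is 0 when its support is infinite; when the
   generators are nonzero and the semigroup is pointed, only finitely many
   lengths l contribute. *)
Definition mobius (x : 'rV[int]_m) : int :=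
  \sum_(l \in [set: nat]) (-1) ^+ l * (nchains l 0 x)%:Z.

End Semigroup.

(* Z[[t_1, ..., t_m, t_1^-1, ..., t_m^-1]]: a formal series is the family of
   its coefficients. *)
Definition fseries (m : nat) : Type := 'rV[int]_m -> int.

Definition fseries1 (m : nat) : fseries m := fun b => (b == 0)%:R.
Arguments fseries1 : clear implicits.

(* Cauchy product; the convolution sum is 0 by convention when infinitely many
   of its terms are nonzero. *)
Definition fseries_mul (m : nat) (f g : fseries m) : fseries m :=
  fun b => \sum_(c \in [set: 'rV[int]_m]) f c * g (b - c).

Fact kernel_idealr_closed (R S : nzRingType) (f : {rmorphism R -> S}) :
  idealr_closed [pred p | f p == 0].
Proof.
split=> [||p u v]; rewrite !inE ?rmorph0 ?rmorph1 ?oner_neq0 //.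
by move=> /eqP hu /eqP hv; rewrite rmorphD rmorphM hu hv mulr0 addr0.
Qed.

Section ToricRing.
Variables (k : fieldType) (m n : nat) (a : 'I_n -> 'rV[int]_m).

(* The Laurent polynomial ring k[t_1^+-1, ..., t_m^+-1] is realised inside the
   fraction field k(t_1, ..., t_m). *)
Definition laurent_monomial (b : 'rV[int]_m) : {fraction {mpoly k[m]}} :=
  \prod_(j < m) (tofrac 'X_j) ^ (b 0 j).

Definition toric_map : {mpoly k[n]} -> {fraction {mpoly k[m]}} :=
  mmap (@tofrac {mpoly k[m]} \o @mpolyC m k)
    (fun i => laurent_monomial (a i)).

HB.instance Definition _ := GRing.RMorphism.on toric_map.

Definition toric_ideal : {pred {mpoly k[n]}} := [pred p | toric_map p == 0].

Fact toric_ideal_idealr_closed : idealr_closed toric_ideal.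
Proof. exact: (kernel_idealr_closed toric_map). Qed.

HB.instance Definition _ :=
  isIdealr.Build {mpoly k[n]} toric_ideal toric_ideal_idealr_closed.

Definition toric_ring : Type := {ideal_quot toric_ideal}.

HB.instance Definition _ := GRing.ComNzRing.on toric_ring.

Definition toric_pi (p : {mpoly k[n]}) : toric_ring :=
  \pi_({ideal_quot toric_ideal}) p.

Definition toric_scale (c : k) (x : toric_ring) : toric_ring :=
  toric_pi c%:MP * x.

Let toric_pi_is (p q : {mpoly k[n]}) :
  [/\ toric_pi 1 = 1, toric_pi (p + q) = toric_pi p + toric_pi q
    & toric_pi (p * q) = toric_pi p * toric_pi q].
Proof. by rewrite /toric_pi; split; rewrite (rmorph1, rmorphD, rmorphM). Qed.

Fact toric_scaleA (c d : k) (x : toric_ring) :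
  toric_scale c (toric_scale d x) = toric_scale (c * d) x.
Proof.
by rewrite /toric_scale mulrA mpolyCM; case: (toric_pi_is c%:MP d%:MP) => _ _ ->.
Qed.

Fact toric_scale1 : left_id 1 toric_scale.
Proof.
by move=> x; rewrite /toric_scale; case: (toric_pi_is 1 1) => -> _ _; rewrite mul1r.
Qed.

Fact toric_scaleDr : right_distributive toric_scale +%R.
Proof. by move=> c x y; rewrite /toric_scale mulrDr. Qed.

Fact toric_scaleDl (x : toric_ring) :
  {morph toric_scale^~ x : c d / c + d}.
Proof.
move=> c d; rewrite /toric_scale mpolyCD.
by case: (toric_pi_is c%:MP d%:MP) => _ -> _; rewrite mulrDl.
Qed.

HB.instance Definition _ := GRing.Zmodule_isLmodule.Build k toric_ring
  toric_scaleA toric_scale1 toric_scaleDr toric_scaleDl.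

Definition homog_part (b : 'rV[int]_m) : set {mpoly k[n]} :=
  [set p | forall u, u \in msupp p -> multidegree a u = b].

Definition toric_part (b : 'rV[int]_m) : set toric_ring :=
  toric_pi @` homog_part b.

End ToricRing.

Definition is_basis (k : fieldType) (V : lmodType k) (U : set V) (d : nat)
    (v : 'I_d -> V) : Prop :=
  U = [set \sum_i c i *: v i | c in [set: 'I_d -> k]] /\
  (forall c : 'I_d -> k, \sum_i c i *: v i = 0 -> forall i, c i = 0).

(* Dimension of a subspace of an arbitrary, possibly infinite-dimensional,
   k-space: the size of a finite basis, and 0 when there is none. *)
Definition dimension (k : fieldType) (V : lmodType k) (U : set V) : nat :=
  xget 0%N [set d | exists v : 'I_d -> V, is_basis U v].

Definition hilbert_series (k : fieldType) (m n : nat)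
    (a : 'I_n -> 'rV[int]_m) : fseries m :=
  fun b => (dimension (@toric_part k m n a b))%:Z.

Definition mobius_series (m n : nat) (a : 'I_n -> 'rV[int]_m) : fseries m :=
  mobius a.

(* Main.v *)
Require Import Defs.
From mathcomp Require Import all_boot all_order all_algebra.
From mathcomp Require Import finmap mpoly.
From mathcomp Require Import boolp classical_sets cardinality fsbigop.

(* Write S for the semigroup and N_l(b) for the number of chains of length l
   from 0 to b.  Two homogeneous polynomials of degree b have proportional
   images under the toric map, so each graded part of the toric ring has
   dimension 1 or 0 and H_S is the indicator series of S.  The coefficient of
   the product at t^b is therefore the sum of mu_S over the interval [0, b].
   Removing the last step of a chain gives
     sum_(0 <= w <= b) N_l(w) = N_l(b) + N_(l+1)(b),
   and the alternating sum over l telescopes to N_0(b) = [b = 0].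
   All sums are finite: by Dickson's lemma, were the exponent vectors
   representing b of unbounded total degree, two of them would be comparable,
   and their difference would be a nonzero vector of multidegree 0, which
   pointedness and the nonvanishing of the generators exclude. *)

Set Implicit Arguments.
Unset Strict Implicit.
Unset Printing Implicit Defensive.

Import Order.TTheory GRing.Theory Num.Theory.

Local Open Scope classical_set_scope.
Local Open Scope ring_scope.

(** * Dimensions of the zero space and of a line *)

Section Dimension.
Variables (k : fieldType) (V : lmodType k).

Lemma dimension_zero : dimension ([set 0] : set V) = 0%N.
Proof.
rewrite /dimension; case: xgetP => // -[//|d] _ [v [span_v free_v]].
have v0 : v ord0 = 0.
  suff : [set 0] (v ord0) by [].
  rewrite span_v /=; exists (fun i => (i == ord0)%:R) => //.
  rewrite (bigD1 ord0) //= scale1r big1 ?addr0 // => i /negPf ->.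
  by rewrite scale0r.
have /(free_v _) /(_ ord0) /eqP :
    \sum_i (fun i : 'I_d.+1 => (i == ord0)%:R : k) i *: v i = 0.
  by rewrite (bigD1 ord0) //= v0 scaler0 add0r big1 // => i /negPf ->;
     rewrite scale0r.
by rewrite eqxx oner_eq0.
Qed.

(** [dimension] returns the size of some basis, so all other sizes must be excluded: size 0 would
    force [e = 0], and two multiples of [e] are always dependent. *)
Lemma dimension_line (e : V) : (forall c : k, c *: e = 0 -> c = 0) ->
  dimension [set c *: e | c in [set: k]] = 1%N.
Proof.
move=> free_e; rewrite /dimension.
case: xgetP => [d _ [v [span_v free_v]]|none].
  have line i : exists c, c *: e = v i.
    have : [set \sum_i c i *: v i | c in [set: 'I_d -> k]] (v i).
      exists (fun j => (j == i)%:R) => //.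
      rewrite (bigD1 i) //= eqxx scale1r big1 ?addr0 // => j /negPf ->.
      by rewrite scale0r.
    by rewrite -span_v => -[c _ <-]; exists c.
  have [c cE] := choice line.
  case: d => [|[|d]] // in v span_v free_v line c cE *.
    have : [set c *: e | c in [set: k]] e by exists 1 => //; rewrite scale1r.
    rewrite span_v => -[c' _]; rewrite big_ord0 => e0.
    by have /eqP := free_e 1 (etrans (scale1r _) (esym e0)); rewrite oner_eq0.
  pose i1 : 'I_d.+2 := lift ord0 ord0.
  pose f (x y : k) (i : 'I_d.+2) :=
    if i == ord0 then x else if i == i1 then y else 0.
  have sum_f x y : \sum_i f x y i *: v i = x *: v ord0 + y *: v i1.
    rewrite (bigD1 ord0) //= (bigD1 i1) //= big1 ?addr0 //.
    by move=> i /andP[/negPf i_0 /negPf i_1]; rewrite /f i_0 i_1 scale0r.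
  (* The relation [c i1 *: v ord0 - c ord0 *: v i1 = 0] gives [c i1 = 0]; then [v i1 = 0], which is
     itself a nontrivial relation. *)
  have c1 : c i1 = 0.
    apply: (free_v (f (c i1) (- c ord0)) _ ord0).
    by rewrite sum_f -!cE !scalerA mulNr [_ * c i1]mulrC scaleNr subrr.
  have /(free_v _)/(_ i1)/eqP : \sum_i f 0 1 i *: v i = 0.
    by rewrite sum_f -!cE c1 !scale0r scaler0 addr0.
  by rewrite /f /= oner_eq0.
exfalso; apply: (none 1%N); exists (fun=> e); split.
  apply/seteqP; split=> [_ [c _ <-]|_ [c _ <-]] /=.
    by exists (fun=> c) => //; rewrite big_ord1.
  by exists (c ord0) => //; rewrite big_ord1.
by move=> c; rewrite big_ord1 => /free_e c0 i; rewrite ord1.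
Qed.

End Dimension.

(** * The Hilbert series as the indicator series of the semigroup *)

Section HilbertSeries.
Variables (k : fieldType) (m n : nat) (a : 'I_n -> 'rV[int]_m).

Lemma mpolyX_frac_neq0 (j : 'I_m) : tofrac ('X_j : {mpoly k[m]}) != 0.
Proof. by rewrite tofrac_eq0 -msupp_eq0 msuppX. Qed.

Lemma laurent_monomial_neq0 (b : 'rV[int]_m) : laurent_monomial k b != 0.
Proof.
by apply/prodf_neq0 => j _; rewrite expfz_neq0 // mpolyX_frac_neq0.
Qed.

Lemma laurent_monomial0 : laurent_monomial k (0 : 'rV[int]_m) = 1.
Proof. by rewrite /laurent_monomial big1 // => j _; rewrite mxE expr0z. Qed.

Lemma laurent_monomialD :
  {morph @laurent_monomial k m : b c / b + c >-> b * c}.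
Proof.
move=> b c; rewrite /laurent_monomial -big_split /=.
by apply: eq_bigr => j _; rewrite mxE expfzDr // mpolyX_frac_neq0.
Qed.

Lemma laurent_monomialMn (b : 'rV[int]_m) (d : nat) :
  laurent_monomial k (b *+ d) = laurent_monomial k b ^+ d.
Proof.
elim: d => [|d IHd]; first by rewrite mulr0n laurent_monomial0.
by rewrite mulrS laurent_monomialD IHd exprS.
Qed.

Lemma toric_mapX (u : 'X_{1..n}) :
  toric_map a 'X_[u] = laurent_monomial k (multidegree a u).
Proof.
rewrite /toric_map mmapX /mmap1 /multidegree.
rewrite (big_morph _ laurent_monomialD laurent_monomial0).
by apply: eq_bigr => i _; rewrite laurent_monomialMn.
Qed.

Lemma toric_mapZ (c : k) (p : {mpoly k[n]}) :
  toric_map a (c *: p) = tofrac c%:MP * toric_map a p.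
Proof. by rewrite /toric_map mmapZ. Qed.

Lemma toric_pi_eq (p q : {mpoly k[n]}) :
  toric_pi a p = toric_pi a q <-> toric_map a p = toric_map a q.
Proof.
rewrite /toric_pi; have /= := Quotient.idealrBE (toric_ideal a) p q.
rewrite unfold_in /= rmorphB subr_eq0 => E.
by split=> /eqP; [rewrite -E|rewrite E] => /eqP.
Qed.

Lemma toric_piZ (c : k) (p : {mpoly k[n]}) :
  toric_pi a (c *: p) = c *: toric_pi a p.
Proof. by rewrite -mul_mpolyC /toric_pi rmorphM. Qed.

(** Every monomial of [p] is sent to the same Laurent monomial, so only the sum of the coefficients
    of [p] survives. *)
Lemma toric_map_homog (b : 'rV[int]_m) (p : {mpoly k[n]}) : homog_part a b p ->
  exists c : k, toric_map a p = tofrac c%:MP * laurent_monomial k b.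
Proof.
move=> p_b; exists (\sum_(u <- msupp p) p@_u).
rewrite {1}[p]mpolyE !raddf_sum /= mulr_suml.
by apply: eq_big_seq => u /p_b <-; rewrite toric_mapZ toric_mapX.
Qed.

Lemma hilbert_seriesE (b : 'rV[int]_m) :
  hilbert_series k a b = (b \in semigroup a)%:R.
Proof.
rewrite /hilbert_series; case: (boolP (b \in _)) => [|/negP]; rewrite inE.
  case=> x _ xb; pose u := [multinom x i | i < n].
  have ub : multidegree a u = b.
    by rewrite -xb /multidegree; apply: eq_bigr => i _; rewrite mnmE.
  suff -> : toric_part b = [set c *: toric_pi a 'X_[u] | c in [set: k]].
    (* If the class of [c *: 'X_[u]] is zero, its toric image, [c] times a nonzero Laurent monomial,
       is zero, hence [c = 0]. *)
    rewrite dimension_line // => c; rewrite -toric_piZ => pi0.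
    have /toric_pi_eq/eqP : toric_pi a (c *: 'X_[u]) = toric_pi a 0.
      by rewrite pi0 /toric_pi rmorph0.
    rewrite rmorph0 toric_mapZ toric_mapX mulf_eq0.
    rewrite (negPf (laurent_monomial_neq0 _)) orbF tofrac_eq0 mpolyC_eq0.
    by move/eqP.
  apply/seteqP; split=> [_ [p p_b <-]|_ [c _ <-]].
    have [c pE] := toric_map_homog p_b; exists c => //.
    by rewrite -toric_piZ; apply/toric_pi_eq; rewrite toric_mapZ toric_mapX ub.
  exists (c *: 'X_[u]); last by rewrite toric_piZ.
  by move=> v /msuppZ_le; rewrite msuppX inE => /eqP ->.
(* No monomial has degree [b], so only the zero polynomial is homogeneous of that degree. *)
move=> nSb; suff -> : toric_part b = [set 0] :> set (toric_ring k a).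
  by rewrite dimension_zero.
apply/seteqP; split=> [_ [p p_b <-] /=|_ ->].
  rewrite [p]mpolyE big_seq big1 => [|u /p_b ub].
    by rewrite /toric_pi rmorph0.
  by case: nSb; exists u.
by exists 0; [move=> u; rewrite msupp0|rewrite /toric_pi rmorph0].
Qed.

End HilbertSeries.

(** * Dickson's lemma *)

Section Dickson.

(** Each index is chosen to minimise [g] over all indices beyond the previous choice, so no later
    value is smaller. *)
Lemma nondecreasing_subsequence (g : nat -> nat) : exists h : nat -> nat,
  {homo h : i j / (i < j)%N} /\ {homo g \o h : i j / (i <= j)%N}.
Proof.
have tail_min N : exists j,
    (N <= j)%N /\ forall i, (N <= i)%N -> (g j <= g i)%N.
  have ex_v : exists v, `[< exists2 i, (N <= i)%N & g i = v >].
    by exists (g N); apply/asboolP; exists N.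
  case: (ex_minnP ex_v) => v /asboolP[j Nj <-] v_min.
  by exists j; split=> // i Ni; apply: v_min; apply/asboolP; exists i.
have [next nextP] := choice tail_min.
pose h i := iter i (next \o succn) (next 0%N).
have h_lt i : (h i < h i.+1)%N by have [] := nextP (h i).+1.
exists h; split; first exact: homo_ltn ltn_trans h_lt.
apply: homo_leq => [//|y x z|[|i]]; first exact: leq_trans.
  by have [_] := nextP 0%N; apply.
by have [_] := nextP (h i).+1; apply; exact: ltn_trans (h_lt i) (h_lt i.+1).
Qed.

Lemma dickson (n : nat) (f : nat -> 'I_n -> nat) :
  exists i j, (i < j)%N /\ forall l, (f i l <= f j l)%N.
Proof.
suff [h [h_lt fh]] : exists h : nat -> nat, {homo h : i j / (i < j)%N} /\
    forall l, l \in enum 'I_n -> {homo (f^~ l) \o h : i j / (i <= j)%N}.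
  exists (h 0%N), (h 1%N); split=> [|l]; first exact: h_lt.
  by apply: (fh l); rewrite ?mem_enum.
(* The sequence is thinned one coordinate at a time; coordinates already monotone stay so along a
   subsequence. *)
elim: (enum 'I_n) => [|l s [h [h_lt fh]]]; first by exists id; split.
have [h' [h'_lt fh']] := nondecreasing_subsequence ((f^~ l) \o h).
exists (h \o h'); split=> [i j /h'_lt /h_lt //|l'].
rewrite inE => /orP[/eqP -> // |/fh fhl' i j ij].
by apply: fhl'; exact: (ltnW_homo h'_lt).
Qed.

End Dickson.

(** * Chains, finiteness and the Möbius function *)

Section Semigroup.
Variables (m n : nat) (a : 'I_n -> 'rV[int]_m).
Local Notation S := (semigroup a).
Local Notation chains l x y := (@chains m n a l x y).

Lemma multidegreeD (x y : 'I_n -> nat) :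
  multidegree a (fun i => x i + y i)%N = multidegree a x + multidegree a y.
Proof. by rewrite -big_split; apply: eq_bigr => i _; rewrite mulrnDr. Qed.

Lemma semigroup0 : S 0.
Proof. by exists (fun=> 0%N) => //; rewrite /multidegree big1. Qed.

Lemma semigroupD (b c : 'rV[int]_m) : S b -> S c -> S (b + c).
Proof.
move=> [x _ <-] [y _ <-]; exists (fun i => x i + y i)%N => //.
exact: multidegreeD.
Qed.

Definition interval (b : 'rV[int]_m) : set 'rV[int]_m :=
  [set w | S w /\ S (b - w)].

Definition extend_chain (l : nat) (y : 'rV[int]_m)
    (z : {ffun 'I_l.+1 -> 'rV[int]_m}) : {ffun 'I_l.+2 -> 'rV[int]_m} :=
  [ffun i : 'I_l.+2 => if (i < l.+1)%N then z (inord i) else y].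

Lemma extend_chainE (l : nat) (y : 'rV[int]_m)
    (z : {ffun 'I_l.+1 -> 'rV[int]_m}) (i : nat) : (i <= l)%N ->
  extend_chain y z (inord i) = z (inord i).
Proof. by move=> il; rewrite ffunE inordK ?ltnS ?il // leqW. Qed.

Lemma extend_chain_max (l : nat) (y : 'rV[int]_m)
    (z : {ffun 'I_l.+1 -> 'rV[int]_m}) : extend_chain y z ord_max = y.
Proof. by rewrite ffunE ltnn. Qed.

Lemma extend_chain_inj (l : nat) (y : 'rV[int]_m) :
  injective (@extend_chain l y).
Proof.
move=> z z' zz'; apply/ffunP => i; have il : (i <= l)%N by rewrite -ltnS.
by rewrite -(inord_val i) -(extend_chainE y z il) zz' extend_chainE.
Qed.

Lemma inord_max (l : nat) : inord l = ord_max :> 'I_l.+1.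
Proof. by apply: val_inj; rewrite /= inordK. Qed.

Lemma inord_0 (l : nat) : inord 0 = ord0 :> 'I_l.+1.
Proof. by apply: val_inj; rewrite /= inordK. Qed.

(** Chains are sorted by their penultimate element [w]. *)
Lemma chainsS (l : nat) (x y : 'rV[int]_m) :
  chains l.+1 x y =
  \bigcup_(w in [set w | lt_semigroup a w y]) @extend_chain l y @` chains l x w.
Proof.
apply/seteqP; split=> [z [z0 z_max z_lt]|_ [w wy [z [z0 z_max z_lt] <-]]].
  exists (z (inord l)) => /=.
    by rewrite -z_max -inord_max; apply: z_lt.
  exists [ffun i : 'I_l.+1 => z (inord i)].
    split=> [||i il]; rewrite !ffunE /= ?inord_0 //.
    by rewrite !inordK ?ltnS // 1?ltnW //; apply: z_lt; exact: leqW.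
  apply/ffunP => i; rewrite ffunE; case: ltnP => [il|li].
    by rewrite ffunE inordK // inord_val.
  by rewrite -z_max; congr (z _); apply/val_inj/anti_leq; rewrite li /= -ltnS.
split; first by rewrite -inord_0 extend_chainE // inord_0.
  exact: extend_chain_max.
move=> i; rewrite ltnS leq_eqVlt => /orP[/eqP ->|il].
  rewrite [inord l.+1]inord_max extend_chain_max extend_chainE // inord_max.
  by rewrite z_max.
by rewrite !extend_chainE //; [exact: z_lt|exact: ltnW].
Qed.

Lemma chains0 (x y : 'rV[int]_m) :
  chains 0 x y = if x == y then [set [ffun=> x]] else set0.
Proof.
case: eqP => [<-|xy]; last first.
  apply/seteqP; split=> // z [z0 z_max _]; apply: xy.
  by rewrite -z0 -z_max; congr (z _); apply: val_inj.
apply/seteqP; split=> [z [z0 _ _]|_ ->]; last by split; rewrite ?ffunE.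
by apply/ffunP => i; rewrite ffunE ord1.
Qed.

(** Each strict step is a nonzero semigroup element, so its exponent vector has total at least 1;
    these vectors are added up. This turns degree bounds into length bounds. *)
Lemma chain_length (l : nat) (x y : 'rV[int]_m) z : chains l x y z ->
  exists u, multidegree a u = y - x /\ (l <= \sum_i u i)%N.
Proof.
elim: l y z => [|l IHl] y z.
  rewrite chains0; case: eqP => [-> _|//].
  by exists (fun=> 0%N); rewrite subrr /multidegree big1.
rewrite chainsS => -[w [[v _ vE] wy] [z' /IHl[u [uE lu]] _]].
exists (fun i => u i + v i)%N; rewrite multidegreeD uE vE; split.
  by rewrite addrC subrKA.
rewrite big_split /= -addn1 leq_add // lt0n sum_nat_eq0.
apply: contra_notN wy => /forallP v0; apply/esym/subr0_eq.
by rewrite -vE /multidegree big1 // => i _; move/eqP: (v0 i) => ->.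
Qed.

Lemma nchains_notin (l : nat) (b : 'rV[int]_m) : ~ S b -> nchains a l 0 b = 0%N.
Proof.
move=> nSb; rewrite /nchains (_ : chains l 0 b = set0) ?fset_set0 ?cardfs0 //.
apply/seteqP; split=> // z /chain_length[u [uE _]]; apply: nSb.
by exists u; rewrite // uE subr0.
Qed.

Hypotheses (a_neq0 : forall i, a i <> 0) (a_pointed : pointed a).

(** If [x i > 0], removing one copy of [a i] shows that [- a i] is also in the semigroup, so
    pointedness forces [a i = 0]. *)
Lemma multidegree_eq0 (x : 'I_n -> nat) :
  multidegree a x = 0 -> forall i, x i = 0%N.
Proof.
move=> x0 i; apply/eqP; rewrite -leqn0 leqNgt; apply/negP => xi.
pose e j := (j == i : nat).
have eE : multidegree a e = a i.
  rewrite /multidegree (bigD1 i) //= /e eqxx big1 ?addr0 // => j /negPf ->.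
  by rewrite mulr0n.
apply: (a_neq0 (i := i)); suff : [set 0 : 'rV[int]_m] (a i) by [].
rewrite -a_pointed; split; first by exists e.
exists (multidegree a (fun j => x j - e j)%N).
  by exists (fun j => x j - e j)%N.
apply/eqP; rewrite eqr_oppLR -addr_eq0 -eE -multidegreeD -x0; apply/eqP.
by apply: eq_bigr => j _; rewrite subnK // /e; case: eqP => // ->.
Qed.

Lemma degree_bound (b : 'rV[int]_m) : exists L, forall x,
  multidegree a x = b -> (\sum_i x i <= L)%N.
Proof.
apply: contrapT => unbounded.
have /choice[f fP] : forall N, exists x : 'I_n -> nat,
    multidegree a x = b /\ (N < \sum_i x i)%N.
  move=> N; apply: contrapT => none; apply: unbounded; exists N => x xb.
  by rewrite leqNgt; apply/negP => Nx; apply: none; exists x.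
(* The total of [f (h i)] is exactly [h i.+1] and exceeds [h i], so the totals strictly increase. *)
pose deg N := (\sum_i f N i)%N; pose h i := iter i deg 0%N.
have h_lt : {homo h : i j / (i < j)%N}.
  by apply: homo_ltn ltn_trans _ => i; have [] := fP (h i).
have [i [j [ij fij]]] := dickson (fun i => f (h i)).
have fij0 : multidegree a (fun l => f (h j) l - f (h i) l)%N = 0.
  apply/(addIr (multidegree a (f (h i)))); rewrite -multidegreeD add0r.
  have [-> _] := fP (h i); have [<- _] := fP (h j).
  by apply: eq_bigr => l _; rewrite subnK.
suff : (h j.+1 <= h i.+1)%N by rewrite leqNgt h_lt.
by apply: leq_sum => l _; rewrite -subn_eq0 (multidegree_eq0 fij0).
Qed.

Lemma interval_finite (b : 'rV[int]_m) : finite_set (interval b).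
Proof.
have [L Lb] := degree_bound b.
pose g (f : {ffun 'I_n -> 'I_L.+1}) := multidegree a (fun i => f i : nat).
apply: (@sub_finite_set _ _ (g @` setT)); last exact/finite_image/finite_finset.
(* Adding exponents of [w] and of [b - w] gives exponents of [b], so each coordinate of [x] is at
   most [L]. *)
move=> _ [[x _ <-] [y _ xy]].
have xL i : (x i < L.+1)%N.
  rewrite ltnS; apply: leq_trans (Lb (fun i => x i + y i)%N _).
    by rewrite (bigD1 i) //= -addnA leq_addr.
  by rewrite multidegreeD xy addrC subrK.
exists [ffun i => Ordinal (xL i)] => //.
by apply: eq_bigr => i _; rewrite ffunE.
Qed.

Lemma chains_finite (l : nat) (b : 'rV[int]_m) : finite_set (chains l 0 b).
Proof.
elim: l b => [|l IHl] b; first by rewrite chains0; case: eqP.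
rewrite chainsS; apply: (@sub_finite_set _ _
  (\bigcup_(w in interval b) @extend_chain l b @` chains l 0 w)).
  move=> _ [w [wb _] [z zw <-]]; exists w; last by exists z.
  split=> //; have [u [uE _]] := chain_length zw.
  by exists u; rewrite // uE subr0.
by apply: bigcup_finite (interval_finite b) _ => w _; exact: finite_image.
Qed.

Lemma nchainsS (l : nat) (b : 'rV[int]_m) :
  nchains a l.+1 0 b =
  (\sum_(w <- (fset_set (interval b) `\ b)%fset) nchains a l 0 w)%N.
Proof.
pose F w := [fset extend_chain b z | z in fset_set (chains l 0 w)]%fset.
have in_F w z : z \in F w ->
    exists2 z', chains l 0 w z' & z = extend_chain b z'.
  move=> /imfsetP[z' /=]; rewrite in_fset_set ?inE; first by exists z'.
  exact: chains_finite.
rewrite /nchains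
  (_ : fset_set _ = \bigcup_(w <- fset_set (interval b) `\ b) F w)%fset.
  rewrite card_fset_sum1 partition_disjoint_bigfcup /=.
    apply: eq_bigr => w _; rewrite -card_fset_sum1 card_imfset //.
    exact: extend_chain_inj.
  (* The blocks are disjoint: a chain determines its truncation, whose endpoint is [w]. *)
  move=> w w' _ _ /eqP ww'; apply/fdisjointP => z /in_F[z1 [_ z1w _] ->].
  apply/negP => /in_F[z2 [_ z2w _]] /extend_chain_inj z12.
  by apply: ww'; rewrite -z1w -z2w z12.
apply/fsetP => z; rewrite in_fset_set; last exact: chains_finite.
apply/idP/bigfcupP => [|[w]].
  rewrite inE chainsS => -[w [wb wb'] [z' z'w <-]]; exists w.
    rewrite andbT !inE in_fset_set; last exact: interval_finite.
    apply/andP; split; first exact/eqP.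
    rewrite inE; split=> //; have [u [uE _]] := chain_length z'w.
    by exists u; rewrite // uE subr0.
  apply/imfsetP; exists z' => //=; rewrite in_fset_set ?inE //.
  exact: chains_finite.
rewrite andbT !inE in_fset_set; last exact: interval_finite.
move=> /andP[/eqP wb]; rewrite inE => -[_ Sbw] /in_F[z' z'w ->].
by rewrite chainsS; exists w => //; exists z'.
Qed.

(** The term [w = b] is split off; the others count chains of length [l.+1] by penultimate element.
    If [b] is not in the semigroup, both sides vanish. *)
Lemma sum_nchains_interval (l : nat) (b : 'rV[int]_m) :
  (\sum_(w <- fset_set (interval b)) nchains a l 0 w =
   nchains a l 0 b + nchains a l.+1 0 b)%N.
Proof.
have finI := interval_finite b.
have [Sb|nSb] := pselect (S b).
  rewrite nchainsS (big_fsetD1 b) //= in_fset_set // inE; split=> //.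
  by rewrite subrr; exact: semigroup0.
rewrite !nchains_notin // big_seq big1 // => w.
rewrite in_fset_set // inE => -[Sw Sbw]; case: nSb.
by rewrite -(subrK w b); exact: semigroupD.
Qed.

Lemma nchains_gt_degree (l L : nat) (b w : 'rV[int]_m) :
    (forall x, multidegree a x = b -> (\sum_i x i <= L)%N) -> S (b - w) ->
  (L < l)%N -> nchains a l 0 w = 0%N.
Proof.
move=> Lb [y _ yE] Ll.
rewrite /nchains (_ : chains l 0 w = set0) ?fset_set0 ?cardfs0 //.
apply/seteqP; split=> // z /chain_length[u [uE lu]].
have := leq_trans Ll lu; rewrite ltnNge => /negP; apply.
apply: leq_trans (Lb (fun i => u i + y i)%N _).
  by rewrite big_split leq_addr.
by rewrite multidegreeD uE yE subr0 addrC subrK.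
Qed.

(** The cutoff [L] depends on [b] alone, so one range of lengths serves the whole interval and the
    two sums can be exchanged. *)
Lemma mobiusE (b w : 'rV[int]_m) (L : nat) :
    (forall x, multidegree a x = b -> (\sum_i x i <= L)%N) -> S (b - w) ->
  mobius a w = \sum_(0 <= l < L.+1) (-1) ^+ l * (nchains a l 0 w)%:Z.
Proof.
move=> Lb Sbw; rewrite /mobius (fsbigE (index_iota 0 L.+1)) ?iota_uniq //.
  by apply: eq_bigl => l; exact: in_setT.
move=> l _; rewrite mem_index_iota /= -leqNgt => Ll.
by rewrite (nchains_gt_degree Lb) ?mulr0.
Qed.

Lemma mobius_notin (b : 'rV[int]_m) : ~ S b -> mobius a b = 0.
Proof.
by move=> nSb; rewrite /mobius fsbig1 // => l _; rewrite nchains_notin // mulr0.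
Qed.

Lemma nchains0 (b : 'rV[int]_m) : nchains a 0 0 b = (b == 0).
Proof.
rewrite /nchains chains0 eq_sym.
by case: eqP => _; rewrite ?fset_set1 ?cardfs1 ?fset_set0 ?cardfs0.
Qed.

Lemma sum_mobius_interval (b : 'rV[int]_m) :
  \sum_(w <- fset_set (interval b)) mobius a w = (b == 0)%:R.
Proof.
have [L Lb] := degree_bound b.
(* The sign makes [t l.+1 - t l] equal to [(-1) ^+ l] times the sum of the chain counts of lengths
   [l] and [l.+1]. *)
pose t l : int := - ((-1) ^+ l * (nchains a l 0 b)%:Z).
have -> : \sum_(w <- fset_set (interval b)) mobius a w =
    \sum_(0 <= l < L.+1) (t l.+1 - t l).
  under eq_big_seq => w.
    rewrite in_fset_set ?inE; last exact: interval_finite.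
    by move=> [_ /(mobiusE Lb) ->]; over.
  rewrite exchange_big /=; apply: eq_bigr => l _.
  rewrite -mulr_sumr -(big_morph Posz PoszD erefl) sum_nchains_interval /t.
  by rewrite exprS mulN1r mulNr !opprK PoszD mulrDr addrC.
(* The upper end [t L.+1] vanishes by the length bound, leaving [- t 0]. *)
rewrite telescope_sumr // /t nchains0 (nchains_gt_degree Lb) // ?subrr.
  by rewrite mulr0 oppr0 add0r opprK expr0 mul1r; case: (b == 0).
exact: semigroup0.
Qed.

End Semigroup.

Theorem theorem3p3 (k : fieldType) (m n : nat) (a : 'I_n -> 'rV[int]_m)
    (a_neq0 : forall i, a i <> 0) (a_pointed : pointed a) :
  fseries_mul (hilbert_series k a) (mobius_series a) = fseries1 m.
Proof.
apply/funext => b; rewrite /fseries_mul /fseries1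
  -(sum_mobius_interval a_neq0 a_pointed).
have in_I c : (c \in fset_set (interval a b)) =
    (c \in semigroup a) && (b - c \in semigroup a).
  rewrite in_fset_set; last exact: interval_finite.
  by apply/idP/andP; rewrite !inE.
rewrite (fsbigTE (fset_set (interval a b))) => [|c].
  (* The reflection [c -> b - c] permutes the interval and matches the convolution with the sum of
     Möbius values. *)
  rewrite [RHS](perm_big [seq b - c | c <- fset_set (interval a b)]).
    rewrite big_map; apply: eq_big_seq => c; rewrite in_I => /andP[cS _].
    by rewrite hilbert_seriesE cS mul1r.
  have b_invol : involutive (fun c => b - c) by move=> c; rewrite subKr.
  apply: uniq_perm; rewrite ?map_inj_uniq ?fset_uniq //; first exact: inv_inj.
  move=> c; rewrite -[c in RHS](subKr b) (mem_map (inv_inj b_invol)).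
  by rewrite !in_I subKr andbC.
(* Off the interval one factor is zero: the Hilbert coefficient at [c] or the Möbius value at
   [b - c]. *)
rewrite in_I hilbert_seriesE.
case: (c \in semigroup a) => /=; last by rewrite mul0r.
by move=> /negP; rewrite inE /mobius_series => /mobius_notin ->; rewrite mulr0.
Qed.
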